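(* Let $m$ be an integer such that $m$ and $m+1$ are both non-squares, let $M=\mathbb{Z}[\sqrt{m},\sqrt{m+1}]$, let $\eta=\sqrt{m}+\sqrt{m+1}$ and $K=\mathbb{Q}(\eta)$. Then $\eta$ lies in the positive unit group $\mathcal{U}_M^+$, $\eta^2$ is a unit in a quadratic subfield of $K$, and there is an explicitly constructible $\mathbb{Z}$-basis $W=\{w_1,w_2,w_3,w_4\}$ of $M$ such that, writing $\eta^k=x_1(k)w_1+\cdots+x_4(k)w_4$ with $x_i(k)\in\mathbb{Z}$, the sequence $\{x_1(k):k\in\mathbb{Z}_{\ge 0}\}$ is a linear divisibility sequence.
   Context: For a $\mathbb{Z}$-module $M$ in a number field $K$, the coefficient ring is $\mathcal{O}_M=\{\alpha\in K:\alpha M\subseteq M\}$ and the positive unit group is $\mathcal{U}_M^+=\{\epsilon\in\mathcal{O}_M: N_{K/\mathbb{Q}}(\epsilon)=1\}$. A linear divisibility sequence (LDS) is an integer sequence $b(k)$ satisfying a linear homogeneous recurrence with constant coefficients such that for all positive integers $n,m$, $n\mid m$ implies $b(n)\mid b(m)$. *)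

(* Defs.v *)
From HB Require Import structures.
From mathcomp Require Import all_boot all_order all_algebra all_field.

Set Implicit Arguments.
Unset Strict Implicit.
Unset Printing Implicit Defensive.

Import Order.TTheory GRing.Theory Num.Theory.
Local Open Scope ring_scope.

Section NumberField.

(* Number fields are handled as subfields K of an ambient finite extension L
   of rat; Z-modules are predicates on L. *)
Variable L : fieldExtType rat.
Implicit Types (K : {subfield L}) (M : L -> Prop) (a b x : L).

(* N_{K/Q}(x), for x in K: the determinant of multiplication by x on the
   Q-vector space K, written in the basis vbasis K (the determinant does not
   depend on that choice).  The value is meaningless when x is not in K. *)
Definition field_norm K x : rat :=
  \det (\matrix_(i < \dim K, j < \dim K)
          coord (vbasis K) j (x * (vbasis K)`_i)).

Definition coef_ring K M : L -> Prop :=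
  fun x => x \in K /\ forall y, M y -> M (x * y).

Definition pos_unit_group K M : L -> Prop :=
  fun x => coef_ring K M x /\ field_norm K x = 1.

Definition ring_of_integers K : L -> Prop :=
  fun x => x \in K /\ integralOver (intr : int -> L) x.

Definition field_unit K : L -> Prop :=
  fun x => ring_of_integers K x /\ exists2 y, ring_of_integers K y & x * y = 1.

(* Z[a, b]: the values at (a, b) of the bivariate polynomials over int. *)
Definition int_adjoin2 a b : L -> Prop :=
  fun x => exists p : {poly {poly int}},
    x = (map_poly (map_poly (intr : int -> L)) p).[a, b].

Definition int_basis n M (w : n.-tuple L) : Prop :=
  (forall x, M x <-> exists c : 'I_n -> int, x = \sum_(i < n) w`_i *~ c i) /\
  (forall c : 'I_n -> int,
     \sum_(i < n) w`_i *~ c i = 0 -> forall i, c i = 0).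

(* With a = sqrt m, b = sqrt (m + 1), writing an element of Z[a, b] as
   c1 + ca a + cb b + cab ab, its first coordinate in this basis is ca + cab. *)
Definition sqrt_basis a b : 4.-tuple L := [tuple a; 1; b; a * b - a].

End NumberField.

(* A recurrence of order d + 1: its constant coefficients are integers, and
   the coefficient of the term of lowest index is nonzero. *)
Definition linear_recurrent (u : nat -> int) : Prop :=
  exists d : nat, exists2 c : 'I_d.+1 -> int,
    c ord0 != 0
    & forall k : nat, u (k + d.+1)%N = \sum_(i < d.+1) c i * u (k + i)%N.

Definition lin_div_seq (u : nat -> int) : Prop :=
  linear_recurrent u /\
  forall n m : nat, (0 < n)%N -> (0 < m)%N -> (n %| m)%N -> (u n %| u m)%Z.

(* Every integer m admits an ambient field containing square roots of m and
   m + 1. *)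
Lemma sqrt_field_exists (m : int) :
  exists (L : fieldExtType rat) (a b : L),
    a ^+ 2 = m%:~R /\ b ^+ 2 = (m + 1)%:~R.
Proof.
have [L [f [[|a [|b [|? ?]]] //= [fa fb] _]]] :=
  num_field_exists [:: sqrtC m%:~R; sqrtC (m + 1)%:~R].
by exists L, a, b; split; apply: (fmorph_inj f);
  rewrite rmorphXn /= ?fa ?fb sqrtCK rmorph_int.
Qed.

(* Main.v *)
(** Since (a + b)(b - a) = 1, eta is a unit with inverse b - a, and eta^2 has
    integral trace 4m + 2 over Q(ab).  In the basis (a, 1, b, ab - a) the first
    coordinate of eta^k is (eta^k - eta^-k) / 2ab for k even and
    (eta^k - eta^-k) / 2a for k odd.  For h even, eta^h + eta^-h is an integer
    T_h, so each coordinate x satisfies x(k + 2h) = T_h x(k + h) - x(k).  Taking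
    h = n for n even, and h = 2n for n odd, x(n) | x(jn) follows by induction on
    j from x(0) = 0 and, for n odd, from x(n) | x(2n) and x(n) | x(3n), which are
    read off eta^n = q a + r b. *)

Require Import Defs.
From HB Require Import structures.
From mathcomp Require Import all_boot all_order all_algebra all_field.
From mathcomp Require Import ring lra zify.

Set Implicit Arguments.
Unset Strict Implicit.
Unset Printing Implicit Defensive.

Import Order.TTheory GRing.Theory Num.Theory.
Local Open Scope ring_scope.

(** * Nonsquare integers and rational squares *)

(** If [q] were nonzero, [p / q] would be a rational square root of [N]. The square of its
    denominator divides that of its numerator, so it is an integer and [N] is a square. *)
Lemma rat_sqr_eq_nonsquare (N : int) (p q : rat) :
    (forall z : int, N <> z ^+ 2) -> p ^+ 2 = N%:~R * q ^+ 2 ->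
  p = 0 /\ q = 0.
Proof.
move=> nsqN; have [-> /eqP|q0 pq] := eqVneq q 0.
  by rewrite expr0n mulr0 sqrf_eq0 => /eqP.
have xN : (p / q) ^+ 2 = N%:~R by rewrite exprMn exprVn pq mulfK ?sqrf_eq0.
move: (p / q) xN => x xN.
have numx : numq x ^+ 2 = N * denq x ^+ 2.
  apply: (@intr_inj rat); rewrite rmorphXn [RHS]rmorphM rmorphXn /= -xN.
  rewrite -[X in _ = X ^+ 2 * _]divq_num_den exprMn exprVn.
  by rewrite mulfVK // sqrf_eq0 intr_eq0 denq_neq0.
have /dvdzP[k numxE] : (denq x %| numq x)%Z.
  by rewrite -(@dvdz_pexp2r _ _ 2) // numx dvdz_mull.
case: (nsqN k); apply: (mulIf (_ : denq x ^+ 2 != 0)).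
  by rewrite sqrf_eq0 denq_neq0.
by rewrite -numx numxE exprMn.
Qed.

(** As [4m(m+1) + 1 = (2m+1)^2], a root [z] would factor 1 as [(2m+1-2z)(2m+1+2z)]. Both factors are
    then 1 or both are -1, so [m = 0] or [m + 1 = 0], a square either way. *)
Lemma mul_succ_nonsquare (m : int) :
    (forall z : int, m <> z ^+ 2) -> (forall z : int, m + 1 <> z ^+ 2) ->
  forall z : int, m * (m + 1) <> z ^+ 2.
Proof.
move=> hm hm1 z mz.
have fac : (2 * m + 1 - 2 * z) * (2 * m + 1 + 2 * z) = 1.
  by transitivity (4 * (m * (m + 1) - z ^+ 2) + 1); [ring | rewrite mz subrr mulr0].
have /orP[/eqP e1|/eqP e1] : 2 * m + 1 - 2 * z \is a GRing.unit.
- by apply/unitrPr; exists (2 * m + 1 + 2 * z).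
- rewrite e1 mul1r in fac; apply: (hm 0); lia.
- rewrite e1 in fac; apply: (hm1 0); lia.
Qed.

(** * The norm in an arbitrary basis *)

Section BasisChange.

Variable L : fieldExtType rat.

(** Transition matrices are mutually inverse ([PP]) and conjugate one multiplication matrix into the
    other ([AE]). The norm can thus be computed in an explicit basis. *)
Lemma field_norm_basis (K : {subfield L}) n (X : n.-tuple L) (x : L) :
    basis_of K X -> x \in K ->
  field_norm K x = \det (\matrix_(i < n, j < n) coord X j (x * X`_i)).
Proof.
move=> bX Kx; have dimK := size_basis bX; subst n.
have bV := vbasisP K; pose V := vbasis K.
pose P (Y Z : (\dim K).-tuple L) := \matrix_(i < \dim K, j < \dim K) coord Z j Y`_i.
pose A (Y : (\dim K).-tuple L) := \matrix_(i < \dim K, j < \dim K) coord Y j (x * Y`_i).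
have memY (Y : (\dim K).-tuple L) (i : 'I_(\dim K)) : basis_of K Y -> Y`_i \in K.
  by move=> bY; rewrite (basis_mem bY) // mem_nth ?size_tuple.
have PP (Y Z : (\dim K).-tuple L) :
    basis_of K Y -> basis_of K Z -> P Y Z *m P Z Y = 1%:M.
  move=> bY bZ; apply/matrixP=> i j; rewrite !mxE.
  rewrite -(coord_free _ _ (basis_free bY)) [in RHS](coord_basis bZ (memY Y i bY)).
  by rewrite linear_sum; apply: eq_bigr => k _; rewrite !mxE linearZ.
have AE (Y Z : (\dim K).-tuple L) :
    basis_of K Y -> basis_of K Z -> A Y *m P Y Z = P Y Z *m A Z.
  move=> bY bZ; apply/matrixP=> i j; rewrite !mxE.
  transitivity (coord Z j (x * Y`_i)).
    rewrite [in RHS](coord_basis bY (rpredM Kx (memY Y i bY))) linear_sum.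
    by apply: eq_bigr => k _; rewrite !mxE linearZ.
  rewrite {1}(coord_basis bZ (memY Y i bY)) mulr_sumr linear_sum.
  by apply: eq_bigr => k _; rewrite !mxE -scalerAr linearZ.
rewrite -[LHS]/(\det (A V)) -[RHS]/(\det (A X)) -[A V]mulmx1 -(PP V X) //.
by rewrite mulmxA AE // -mulmxA !det_mulmx mulrCA -det_mulmx PP // det1 mulr1.
Qed.

End BasisChange.

Lemma dvdz_rec2 (v : nat -> int) (d T : int) :
    (forall j, v j.+2 = T * v j.+1 - v j) -> (d %| v 0%N)%Z -> (d %| v 1%N)%Z ->
  forall j, (d %| v j)%Z.
Proof.
move=> vS v0 v1 j; suff [] : (d %| v j)%Z /\ (d %| v j.+1)%Z by [].
elim: j => // j [IH1 IH2]; split=> //.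
by rewrite vS rpredB // dvdz_mull.
Qed.

(** * Closure properties of [Z[a, b]] *)

Section IntAdjoin.

Variables (L : fieldExtType rat) (a b : L).

Lemma int_adjoin2D (x y : L) :
  int_adjoin2 a b x -> int_adjoin2 a b y -> int_adjoin2 a b (x + y).
Proof. by move=> [p ->] [q ->]; exists (p + q); rewrite rmorphD !hornerD. Qed.

Lemma int_adjoin2M (x y : L) :
  int_adjoin2 a b x -> int_adjoin2 a b y -> int_adjoin2 a b (x * y).
Proof. by move=> [p ->] [q ->]; exists (p * q); rewrite rmorphM !hornerM. Qed.

Lemma int_adjoin2_int (c : int) : int_adjoin2 a b c%:~R.
Proof. by exists c%:P%:P; rewrite !map_polyC !hornerC /= map_polyC hornerC. Qed.

Lemma int_adjoin2_l : int_adjoin2 a b a.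
Proof. by exists 'X; rewrite map_polyX hornerX hornerC. Qed.

Lemma int_adjoin2_r : int_adjoin2 a b b.
Proof. by exists 'X%:P; rewrite map_polyC hornerC /= map_polyX hornerX. Qed.

End IntAdjoin.

(* The matrix of multiplication by a + b in the basis (1, a, b, ab). *)
Lemma det_mul_sqrtD (R : comPzRingType) (m : R) :
  \det (\matrix_(i < 4, j < 4) nth 0 (nth [::] [:: [:: 0; 1; 1; 0]; [:: m; 0; 0; 1];
  [:: m + 1; 0; 0; 1]; [:: 0; m + 1; m; 0]] i) j) = 1.
Proof.
set A := matrix_of_fun _ _.
rewrite (expand_det_row A ord0) !big_ord_recl big_ord0.
have -> : A ord0 ord0 = 0 by rewrite mxE.
have -> : A ord0 (lift ord0 (lift ord0 (lift ord0 ord0))) = 0 by rewrite mxE.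
rewrite !mul0r add0r !addr0 /cofactor.
rewrite !(expand_det_row _ (ord0 : 'I_3)) !big_ord_recl !big_ord0 /cofactor.
rewrite !(expand_det_row _ (ord0 : 'I_2)) !big_ord_recl !big_ord0 /cofactor.
by rewrite !det_mx11 !mxE /= /bump /=; ring.
Qed.

(* The coordinates of eta^k on (1, a, b, ab). *)
Fixpoint sqrtD_coord (m : int) (k : nat) : int * int * int * int :=
  if k is k'.+1 then
    let: (p, q, r, s) := sqrtD_coord m k' in
    (m * q + (m + 1) * r, p + (m + 1) * s, p + m * s, q + r)
  else (1, 0, 0, 0).

(** * Linear independence of [1, a, b, ab] over the rationals *)

Section SqrtField.

Variables (m : int) (L : fieldExtType rat) (a b : L).
Hypothesis hm : forall z : int, m <> z ^+ 2.
Hypothesis hm1 : forall z : int, m + 1 <> z ^+ 2.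
Hypothesis ha : a ^+ 2 = m%:~R.
Hypothesis hb : b ^+ 2 = (m + 1)%:~R.

Let hb' : b ^+ 2 = m%:~R + 1.
Proof. by rewrite hb rmorphD. Qed.

Lemma sqrt_ext_free (p q r s : rat) :
    p%:A + q%:A * a + r%:A * b + s%:A * (a * b) = 0 ->
  [/\ p = 0, q = 0, r = 0 & s = 0].
Proof.
(* Q(a) and Q(b) differ: comparing norms from Q(a) in
   (p + q a)^2 = (m + 1) (r + s a)^2 yields the product of two factors below. *)
have in1 (u v : rat) : u%:A + v%:A * a = 0 -> u = 0 /\ v = 0.
  move=> uv; apply: (rat_sqr_eq_nonsquare hm).
  apply: (fmorph_inj (in_alg L)); rewrite [RHS]rmorphM !rmorphXn rmorph_int /=.
  have {}uv : u%:A = - (v%:A * a) by apply/eqP; rewrite -addr_eq0 uv.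
  by rewrite uv sqrrN exprMn ha mulrC.
have m0 : m%:~R != 0 :> rat by rewrite intr_eq0; apply/eqP => m0; case: (@hm 0).
move=> pqrs.
have sqE : (p%:A + q%:A * a) ^+ 2 = (r%:A + s%:A * a) ^+ 2 * (m%:~R + 1) :> L.
  have -> : p%:A + q%:A * a = - ((r%:A + s%:A * a) * b) :> L.
    by apply/eqP; rewrite -addr_eq0 -pqrs; apply/eqP; ring.
  by rewrite sqrrN exprMn hb'.
(* The coefficients on [1] and [a] in the squared relation [sqE] vanish separately by [in1]. *)
have [e1 e2] : p ^+ 2 + m%:~R * q ^+ 2
      - (m%:~R + 1) * (r ^+ 2 + m%:~R * s ^+ 2) = 0 /\
    2 * (p * q - (m%:~R + 1) * (r * s)) = 0.
  apply: in1; rewrite -!in_algE.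
  rewrite !(rmorphB, rmorphD, rmorphXn, rmorphM, rmorph_int, rmorph_nat) /= scale1r.
  transitivity ((p%:A + q%:A * a) ^+ 2
    - (r%:A + s%:A * a) ^+ 2 * (m%:~R + 1) : L); last by rewrite sqE subrr.
  by rewrite -!ha; ring.
have : (p ^+ 2 - m%:~R * q ^+ 2 - (m%:~R + 1) * (r ^+ 2 - m%:~R * s ^+ 2))
     * (p ^+ 2 - m%:~R * q ^+ 2 + (m%:~R + 1) * (r ^+ 2 - m%:~R * s ^+ 2)) = 0.
  have {}e1 : p ^+ 2 + m%:~R * q ^+ 2
      = (m%:~R + 1) * (r ^+ 2 + m%:~R * s ^+ 2) by apply/eqP; rewrite -subr_eq0 e1.
  have {}e2 : p * q = (m%:~R + 1) * (r * s) by lra.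
  transitivity ((p ^+ 2 + m%:~R * q ^+ 2) ^+ 2 - 4 * m%:~R * (p * q) ^+ 2
    - (m%:~R + 1) ^+ 2 * (r ^+ 2 - m%:~R * s ^+ 2) ^+ 2); first by ring.
  by rewrite e1 e2; ring.
(* Each factor, added to e1, gives p^2 and m q^2 as nonsquare multiples of
   squares. *)
move/eqP; rewrite mulf_eq0 => /orP[] /eqP e3.
  have [p0 r0] : p = 0 /\ r = 0.
    by apply: (rat_sqr_eq_nonsquare hm1); rewrite rmorphD /=; lra.
  have [q0 s0] : q = 0 /\ s = 0.
    apply: (rat_sqr_eq_nonsquare hm1); apply: (mulfI m0).
    by rewrite rmorphD /=; move: e1; rewrite p0 r0; lra.
  by [].
have [p0 s0] : p = 0 /\ s = 0.
  apply: (rat_sqr_eq_nonsquare (mul_succ_nonsquare hm hm1)).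
  by rewrite rmorphM rmorphD /=; lra.
(* What remains is [m q^2 = (m+1) r^2]; multiplying by [m] turns it into [(m q)^2 = m(m+1) r^2]. *)
have [q0 r0] : m%:~R * q = 0 /\ r = 0.
  apply: (rat_sqr_eq_nonsquare (mul_succ_nonsquare hm hm1)).
  rewrite rmorphM rmorphD /= exprMn expr2 -!mulrA; congr (_ * _).
  by move: e1; rewrite p0 s0; lra.
by split=> //; apply/eqP; move/eqP: q0; rewrite mulf_eq0 (negPf m0).
Qed.

Let X := [tuple 1; a; b; a * b].

Lemma sqrt_ext_coordE (p q r s : rat) :
  p%:A + q%:A * a + r%:A * b + s%:A * (a * b)
  = \sum_(i < 4) [:: p; q; r; s]`_i *: X`_i.
Proof. by rewrite !big_ord_recl big_ord0 /= !mulr_algl addr0 !addrA. Qed.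

Lemma sqrt_ext_tuple_free : free X.
Proof.
apply/freeP=> k k0.
have [] := @sqrt_ext_free (k 0) (k 1) (k 2) (k 3).
  rewrite sqrt_ext_coordE -[RHS]k0; apply: eq_bigr.
  by case=> [[|[|[|[|//]]]] lti] _; congr (k _ *: _); apply: val_inj.
move=> k0' k1' k2' k3' [[|[|[|[|//]]]] lti];
  [rewrite -k0' | rewrite -k1' | rewrite -k2' | rewrite -k3']; congr k; exact: val_inj.
Qed.

(** * The quartic field generated by [a + b], and the norm of [a + b] *)

Let K : {subfield L} := <<1; a + b>>%AS.

Lemma inv_sqrtD : (a + b) * (b - a) = 1.
Proof. by transitivity (b ^+ 2 - a ^+ 2); [ring | rewrite hb' ha; ring]. Qed.

Lemma sqrtD_mem : a + b \in K.
Proof. exact: memv_adjoin. Qed.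

Lemma sqrtB_mem : b - a \in K.
Proof.
have <- : (a + b)^-1 = b - a by apply: mulr1_eq; apply: inv_sqrtD.
by rewrite rpredV sqrtD_mem.
Qed.

(** Up to the factor 1/2, [a] and [b] are the difference and the sum of [a + b] and its inverse
    [b - a]. *)
Lemma sqrt_mem : a \in K /\ b \in K.
Proof.
have two_mem : 2%:R^-1 \in K by rewrite rpredV rpred_nat.
have two0 : 2%:R != 0 :> L by rewrite -(rmorph_nat (in_alg L)) fmorph_eq0.
split.
  have -> : a = 2%:R^-1 * ((a + b) - (b - a)) by field.
  by rewrite rpredM // rpredB ?sqrtD_mem ?sqrtB_mem.
have -> : b = 2%:R^-1 * ((a + b) + (b - a)) by field.
by rewrite rpredM // rpredD ?sqrtD_mem ?sqrtB_mem.
Qed.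

Lemma sqrtD_sqr_trace : (4 * m + 2)%:~R = (a + b) ^+ 2 + (b - a) ^+ 2 :> L.
Proof.
transitivity (2 * (a ^+ 2 + b ^+ 2)); last by ring.
by rewrite ha hb' rmorphD rmorphM /=; ring.
Qed.

(** Multiply the trace identity by [(a + b)^2]. This one equation bounds the degree of [K], makes
    [(a + b)^2] integral and yields the recurrence of order 4. *)
Lemma sqrtD_sqr_root : (a + b) ^+ 2 ^+ 2 = (4 * m + 2)%:~R * (a + b) ^+ 2 - 1.
Proof.
rewrite sqrtD_sqr_trace mulrDl -[(b - a) ^+ 2 * _]exprMn [(b - a) * _]mulrC.
by rewrite inv_sqrtD expr1n addrK.
Qed.

Lemma sqrtB_sqr_root : (b - a) ^+ 2 ^+ 2 = (4 * m + 2)%:~R * (b - a) ^+ 2 - 1.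
Proof.
rewrite sqrtD_sqr_trace mulrDl -[(a + b) ^+ 2 * _]exprMn inv_sqrtD expr1n.
by rewrite addrAC subrr add0r.
Qed.

(** At least 4 because [K] contains the free family [X]; at most 4 because [a + b] is a root of the
    quartic [X^4 - (4m+2) X^2 + 1]. *)
Lemma dim_sqrt_ext : \dim K = 4%N.
Proof.
have [Ka Kb] := sqrt_mem.
apply/eqP; rewrite eqn_leq; apply/andP; split; last first.
  have /eqP dimX := sqrt_ext_tuple_free.
  rewrite -[4%N]/(size X) -dimX; apply/dimvS/span_subvP => x.
  rewrite !inE => /or4P[] /eqP->; rewrite ?mem1v //.
  by rewrite rpredM.
rewrite dim_Fadjoin dimv1 muln1 -ltnS -size_minPoly.
pose q : {poly L} := 'X^4 - ((4 * m + 2)%:~R%:P * 'X^2 - 1).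
have szq : size q = 5.
  rewrite size_polyDl size_polyXn // size_polyN.
  rewrite (leq_ltn_trans (size_polyD _ _)) // size_polyN size_poly1 gtn_max andbT.
  by rewrite mul_polyC (leq_ltn_trans (size_scale_leq _ _)) ?size_polyXn.
have q0 : q != 0 by rewrite -size_poly_gt0 szq.
rewrite -[4.+1]szq; apply: dvdp_leq => //; apply: minPoly_dvdp.
  by rewrite !(rpredB, rpredM, rpredX) ?polyOverX ?rpred1 // polyOverC rpred_int.
rewrite /root !(hornerD, hornerN, hornerCM, hornerXn) -polyC1 hornerC.
rewrite subr_eq0 (exprM _ 2 2).
by rewrite sqrtD_sqr_root.
Qed.

Lemma sqrt_ext_basis : basis_of K X.
Proof.
have [Ka Kb] := sqrt_mem.
rewrite basisEfree sqrt_ext_tuple_free dim_sqrt_ext /= andbT.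
apply/span_subvP => x; rewrite !inE => /or4P[] /eqP->; rewrite ?mem1v //.
by rewrite rpredM.
Qed.

Lemma field_norm_sqrtD : field_norm K (a + b) = 1.
Proof.
rewrite (field_norm_basis sqrt_ext_basis sqrtD_mem).
rewrite -[RHS](@det_mul_sqrtD _ (m%:~R : rat)); congr (\det _); apply/matrixP=> i j.
rewrite mxE [RHS]mxE.
pose k (l : 'I_4) := nth 0 (nth [::] [:: [:: 0; 1; 1; 0]; [:: m%:~R; 0; 0; 1];
  [:: m%:~R + 1; 0; 0; 1]; [:: 0; m%:~R + 1; m%:~R; 0]] i) l : rat.
(* Row [i] holds the coordinates of [(a + b) * X_i], so it suffices to expand the products of
   [a + b] with [1, a, b, ab]. *)
rewrite -[RHS]/(k j) -(coord_sum_free _ _ sqrt_ext_tuple_free).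
congr (coord _ _ _).
rewrite !big_ord_recl big_ord0 /k => {k}.
case: i => [[|[|[|[|//]]]] lti] /=;
    rewrite ?scale0r ?scale1r ?scalerDl ?scaler_int ?scale1r.
- ring.
- by rewrite -ha; ring.
- by transitivity (a * b + b ^+ 2); [ring | rewrite hb'; ring].
- rewrite -[a *~ m]mulrzr -[b *~ m]mulrzr -ha.
  transitivity (a ^+ 2 * b + b ^+ 2 * a); first ring.
  by rewrite hb' -ha; ring.
Qed.

(** * The quadratic subfield generated by [ab] *)

Let F : {subfield L} := <<1; a * b>>%AS.

Lemma quadratic_sub : (F <= K)%VS.
Proof.
have [Ka Kb] := sqrt_mem.
by apply/FadjoinP; split; [apply: sub1v | apply: rpredM].
Qed.

(** A rational [ab] would contradict the independence of [1] and [ab]; conversely [ab] is a root of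
    [X^2 - m(m+1)]. *)
Lemma dim_quadratic : \dim F = 2%N.
Proof.
apply/eqP; rewrite dim_Fadjoin dimv1 muln1 eqn_leq; apply/andP; split; last first.
  rewrite ltnNge leq_eqVlt negb_or ltnS leqn0 adjoin_deg_eq1.
  rewrite -lt0n adjoin_degreeE divn_gt0 ?adim_gt0 // dimvS ?subv_adjoin // andbT.
  apply/negP=> /vlineP[k abk].
  have [] := @sqrt_ext_free (- k) 0 0 1.
    by rewrite abk !scale0r !mul0r !addr0 mulr_algl scale1r scaleNr addNr.
  by move=> _ _ _ /eqP; rewrite oner_eq0.
pose q : {poly L} := 'X^2 - (m * (m + 1))%:~R%:P.
have q2 : size q = 3 by rewrite size_XnsubC.
have q0 : q != 0 by rewrite -size_poly_gt0 q2.
rewrite -ltnS -size_minPoly -[2.+1]q2; apply: dvdp_leq => //; apply: minPoly_dvdp.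
  by rewrite rpredB ?rpredX ?polyOverX // polyOverC rpred_int.
rewrite /root !(hornerD, hornerN, hornerXn, hornerC) exprMn ha hb.
by rewrite -intrM subrr.
Qed.

Lemma sqr_root_ring_of_integers (y : L) :
  y \in F -> y ^+ 2 = (4 * m + 2)%:~R * y - 1 -> ring_of_integers F y.
Proof.
move=> Fy y2; split=> //; exists ('X^2 - ((4 * m + 2) *: 'X - 1)).
  rewrite monicE lead_coefDl ?lead_coefXn // size_polyXn size_polyN.
  rewrite (leq_ltn_trans (size_polyD _ _)) // size_polyN size_poly1 gtn_max andbT.
  by rewrite (leq_ltn_trans (size_scale_leq _ _)) ?size_polyX.
rewrite /root !(rmorphB, rmorphXn) /= map_polyZ /= map_polyX rmorph1.
rewrite !(hornerD, hornerN, hornerZ, hornerXn, hornerX) -polyC1 hornerC.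
by rewrite subr_eq0 y2.
Qed.

(** The inverse [(b - a)^2] is the conjugate of [(a + b)^2] under [ab -> -ab], so both lie in [F]
    and satisfy the same monic integral quadratic. *)
Lemma field_unit_sqrtD_sqr : field_unit F ((a + b) ^+ 2).
Proof.
have Fab : a * b \in F by apply: memv_adjoin.
have F2ab : 2 * (a * b) \in F by apply: rpredM => //; exact: rpred_nat.
have Fint (c : int) : c%:~R \in F by exact: rpred_int.
have eE : (a + b) ^+ 2 = (m + (m + 1))%:~R + 2 * (a * b).
  by rewrite intrD -ha -hb; ring.
have fE : (b - a) ^+ 2 = (m + (m + 1))%:~R - 2 * (a * b).
  by rewrite intrD -ha -hb; ring.
split.
  apply: sqr_root_ring_of_integers; first by rewrite eE rpredD.
  exact: sqrtD_sqr_root.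
exists ((b - a) ^+ 2); last by rewrite -exprMn inv_sqrtD expr1n.
apply: sqr_root_ring_of_integers; first by rewrite fE rpredB.
exact: sqrtB_sqr_root.
Qed.

(** * The integral basis of [Z[a, b]] *)

Let lin (p q r s : int) : L := p%:~R + q%:~R * a + r%:~R * b + s%:~R * (a * b).

Lemma sqrt_lin_comb_mem (p q r s : int) : int_adjoin2 a b (lin p q r s).
Proof.
have Mint c : int_adjoin2 a b c%:~R by exact: int_adjoin2_int.
have Ma : int_adjoin2 a b a by exact: int_adjoin2_l.
have Mb : int_adjoin2 a b b by exact: int_adjoin2_r.
by do !(apply: int_adjoin2D || apply: int_adjoin2M) => //.
Qed.

Lemma int_adjoin2_lin_comb (x : L) : int_adjoin2 a b x ->
  exists p q r s : int, x = lin p q r s.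
Proof.
case=> P ->; elim/poly_ind: P => [|P c [p [q [r [s IH]]]]].
  by exists 0, 0, 0, 0; rewrite /lin rmorph0 !horner0 !mul0r !addr0.
have [t [u cE]] : exists t u : int, (map_poly intr c).[b] = t%:~R + u%:~R * b.
  elim/poly_ind: c => [|c d [t [u IHc]]].
    by exists 0, 0; rewrite rmorph0 horner0 mul0r addr0.
  exists (d + u * (m + 1)), t; rewrite rmorphD rmorphM /= map_polyX map_polyC /=.
  by rewrite hornerD hornerMX IHc hornerC mulrDl -mulrA -expr2 hb; ring.
(* A Horner step: multiply [p + q a + r b + s ab] by [a], reduce with [a^2 = m], and add the
   coefficient [t + u b]. *)
exists (q * m + t), p, (s * m + u), r.
rewrite rmorphD rmorphM /= map_polyX map_polyC /= hornerD hornerMX hornerD hornerM.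
rewrite !hornerC IH cE.
transitivity (t%:~R + u%:~R * b + p%:~R * a + q%:~R * a ^+ 2 + r%:~R * (a * b)
  + s%:~R * (a ^+ 2 * b)); first by rewrite /lin; ring.
by rewrite ha /lin; ring.
Qed.

Lemma lin_eq0 (p q r s : int) :
  lin p q r s = 0 -> [/\ p = 0, q = 0, r = 0 & s = 0].
Proof.
move=> l0; have intE (c : int) : c%:~R = (c%:~R : rat)%:A :> L.
  by rewrite scaler_int.
have [] := @sqrt_ext_free p%:~R q%:~R r%:~R s%:~R.
  by rewrite -!intE.
by move=> /eqP + /eqP + /eqP + /eqP; rewrite !intr_eq0 => /eqP-> /eqP-> /eqP-> /eqP->.
Qed.

Lemma sqrt_basis_sumE (c : 'I_4 -> int) :
  \sum_(i < 4) (sqrt_basis a b)`_i *~ c i = lin (c 1) (c 0 - c 3) (c 2) (c 3).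
Proof.
under eq_bigr do rewrite -mulrzr.
rewrite !big_ord_recl big_ord0 /=.
have -> : lift ord0 ord0 = 1 :> 'I_4 by exact: val_inj.
have -> : lift ord0 (lift ord0 ord0) = 2 :> 'I_4 by exact: val_inj.
have -> : lift ord0 (lift ord0 (lift ord0 ord0)) = 3 :> 'I_4 by exact: val_inj.
have -> : ord0 = 0 :> 'I_4 by exact: val_inj.
by rewrite /lin rmorphB; ring.
Qed.

Lemma sqrt_basis_int_basis : int_basis (int_adjoin2 a b) (sqrt_basis a b).
Proof.
split=> [x|c c0 i].
  split=> [/int_adjoin2_lin_comb[p [q [r [s ->]]]] | [c ->]].
    (* Inverse of the coordinate change in [sqrt_basis_sumE]: the coefficient on [a] is
       [c 0 - c 3]. *)
    by exists (fun i => [:: q + s; p; r; s]`_i); rewrite sqrt_basis_sumE /= addrK.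
  by rewrite sqrt_basis_sumE; apply: sqrt_lin_comb_mem.
have [c1 c03 c2 c3] := lin_eq0 (etrans (esym (sqrt_basis_sumE c)) c0).
move: c03; rewrite c3 subr0 => c00.
by case: i => [[|[|[|[|//]]]] lti];
  [rewrite -c00 | rewrite -c1 | rewrite -c2 | rewrite -c3]; congr c; exact: val_inj.
Qed.

(** In odd powers of [a + b] the coefficient [s] vanishes, in even powers [q] does; the sum [q + s]
    therefore selects the one that may survive. *)
Lemma sqrt_basis_coord0 (c : 'I_4 -> int) (p q r s : int) :
  \sum_(i < 4) (sqrt_basis a b)`_i *~ c i = lin p q r s -> c ord0 = q + s.
Proof.
rewrite sqrt_basis_sumE => /eqP; rewrite -subr_eq0 => /eqP e.
have -> : ord0 = 0 :> 'I_4 by exact: val_inj.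
have [|_ /eqP + _ /eqP] := @lin_eq0 (c 1 - p) (c 0 - c 3 - q) (c 2 - r) (c 3 - s).
  by rewrite -[RHS]e /lin !rmorphB /=; ring.
by rewrite !subr_eq0 => /eqP<- /eqP<-; rewrite subrK.
Qed.

(** * Powers of [a + b] *)

Lemma sqrtD_expE (k : nat) : let: (p, q, r, s) := sqrtD_coord m k in
  (a + b) ^+ k = lin p q r s.
Proof.
elim: k => [|k] /=; first by rewrite /lin; ring.
case: (sqrtD_coord m k) => [[[p q] r] s] IH; rewrite exprS IH /lin.
rewrite !(rmorphD, rmorphM) /=.
transitivity (q%:~R * a ^+ 2 + r%:~R * b ^+ 2 + (p%:~R + s%:~R * b ^+ 2) * a
  + (p%:~R + s%:~R * a ^+ 2) * b + (q%:~R + r%:~R) * (a * b)); first by ring.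
by rewrite hb' ha; ring.
Qed.

Lemma sqrtD_exp_even (j : nat) : exists U V : int,
  (a + b) ^+ j.*2 = U%:~R + V%:~R * (a * b) /\
  (b - a) ^+ j.*2 = U%:~R - V%:~R * (a * b).
Proof.
elim: j => [|j [U [V [IH1 IH2]]]]; first by exists 1, 0; rewrite mul0r subr0 addr0.
(* Multiplication of [U + V ab] by [(a + b)^2 = 2m + 1 + 2ab]; conjugating [ab] gives the second
   identity. *)
exists ((2 * m + 1) * U + 2 * m * (m + 1) * V), (2 * U + (2 * m + 1) * V).
rewrite doubleS !exprSr IH1 IH2 !(rmorphD, rmorphM) /=; split.
  transitivity ((U%:~R + V%:~R * (a * b)) * (a ^+ 2 + b ^+ 2) + 2 * U%:~R * (a * b)
    + 2 * V%:~R * (a ^+ 2 * b ^+ 2)); first by ring.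
  by rewrite hb' ha; ring.
transitivity ((U%:~R - V%:~R * (a * b)) * (a ^+ 2 + b ^+ 2) - 2 * U%:~R * (a * b)
  + 2 * V%:~R * (a ^+ 2 * b ^+ 2)); first by ring.
by rewrite hb' ha; ring.
Qed.

(** [T] is [(a + b)^2j + (b - a)^2j = 2U], where the [ab] parts cancel. Multiplying by [(a + b)^2j]
    removes the inverse power. *)
Lemma sqrtD_exp_trace (j : nat) : exists T : int,
  (a + b) ^+ (j.*2).*2 + 1 = T%:~R * (a + b) ^+ j.*2.
Proof.
have [U [V [EU EV]]] := sqrtD_exp_even j; exists (U + U).
have -> : (U + U)%:~R = (a + b) ^+ j.*2 + (b - a) ^+ j.*2 :> L.
  by rewrite EU EV intrD; ring.
rewrite mulrDl -[X in _ = _ + X]exprMn [(b - a) * _]mulrC inv_sqrtD expr1n.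
by rewrite -[in LHS]addnn exprD.
Qed.

Lemma sqrtD_exp_odd (n : nat) : odd n -> exists q r : int,
  (a + b) ^+ n = lin 0 q r 0.
Proof.
move=> oddn; have [U [V [EU _]]] := sqrtD_exp_even n./2.
(* Coefficients on [a] and [b] of [(a + b)(U + V ab)]. *)
exists (U + (m + 1) * V), (U + m * V).
rewrite -(odd_double_half n) oddn exprS EU /lin !(rmorphD, rmorphM) /=.
transitivity ((U%:~R + V%:~R * b ^+ 2) * a + (U%:~R + V%:~R * a ^+ 2) * b).
  by ring.
by rewrite hb' ha; ring.
Qed.

(** * Recurrence and divisibility of the coordinate sequences *)

Variable x : 'I_4 -> nat -> int.
Hypothesis xE : forall k : nat,
  (a + b) ^+ k = \sum_(i < 4) (sqrt_basis a b)`_i *~ x i k.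

(** Multiply the hypothesis by [(a + b)^k] and compare coordinates, using the independence of the
    basis over the integers. *)
Lemma coord_exp_rec (h : nat) (T : int) :
    (a + b) ^+ h.*2 + 1 = T%:~R * (a + b) ^+ h ->
  forall (k : nat) (i : 'I_4), x i (k + h.*2)%N = T * x i (k + h)%N - x i k.
Proof.
move=> hT k i; apply/eqP; rewrite -subr_eq0; apply/eqP; move: i.
apply: (proj2 sqrt_basis_int_basis (fun i => _)).
transitivity ((a + b) ^+ (k + h.*2) - (T%:~R * (a + b) ^+ (k + h) - (a + b) ^+ k)).
  rewrite !xE mulr_sumr -!sumrB; apply: eq_bigr => i _.
  by rewrite mulrzl !mulrzBr [T * _]mulrC mulrzA.
by rewrite !exprD [T%:~R * _]mulrCA -hT; ring.
Qed.

Lemma coord_exp_linear_recurrent (i : 'I_4) : linear_recurrent (x i).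
Proof.
(* Order [3 + 1 = 4]: the case [h = 2], [T = 4m + 2] reads [u(k+4) = (4m+2) u(k+2) - u(k)]. *)
exists 3%N, (fun j : 'I_4 => [:: -1; 0; 4 * m + 2; 0]`_j) => [//|k].
have h2 : (a + b) ^+ 2.*2 + 1 = (4 * m + 2)%:~R * (a + b) ^+ 2.
  by rewrite (exprM _ 2 2) sqrtD_sqr_root subrK.
rewrite (coord_exp_rec h2) !big_ord_recl big_ord0 /= addn0.
by rewrite !mul0r !addr0 add0r mulN1r addrC.
Qed.

Lemma coord0_exp_dvd (n k : nat) : (n %| k)%N -> (x ord0 n %| x ord0 k)%Z.
Proof.
case/dvdnP => j ->.
have x0 : x ord0 0 = 0.
  rewrite -[RHS]addr0; apply: (@sqrt_basis_coord0 (x ^~ 0%N) 1 0 0 0).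
  by rewrite -xE expr0 /lin; ring.
have [oddn|evenn] := boolP (odd n); last first.
  have [T hT] := sqrtD_exp_trace n./2.
  rewrite even_halfK // in hT.
  apply: (dvdz_rec2 (v := fun j => x ord0 (j * n)%N) (T := T)) => [l||].
  - have -> : (l.+2 * n = l * n + n.*2)%N by lia.
    by rewrite (coord_exp_rec hT) mulSn [(n + _)%N]addnC.
  - by rewrite x0 dvdz0.
  - by rewrite mul1n.
have [T hT] := sqrtD_exp_trace n.
have [q [r En]] := sqrtD_exp_odd oddn.
have xn : x ord0 n = q.
  by rewrite -[RHS]addr0; apply: (@sqrt_basis_coord0 (x ^~ n) 0 q r 0); rewrite -xE.
(* As [n] is odd, the recurrence advances by [2n], so the even ([e = 0]) and odd ([e = 1]) multiples
   of [n] form separate sequences. *)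
have stepn e l : x ord0 ((l.+2.*2 + e) * n)%N
    = T * x ord0 ((l.+1.*2 + e) * n)%N - x ord0 ((l.*2 + e) * n)%N.
  have -> : ((l.+2.*2 + e) * n = (l.*2 + e) * n + n.*2.*2)%N by lia.
  have -> : ((l.+1.*2 + e) * n = (l.*2 + e) * n + n.*2)%N by lia.
  exact: coord_exp_rec hT _ _.
(* The rational part of [(q a + r b)^2 = A + 2qr ab]. *)
pose A := q ^+ 2 * m + r ^+ 2 * (m + 1).
have x2n : x ord0 (2 * n)%N = 2 * q * r.
  rewrite -[RHS]add0r; apply: (@sqrt_basis_coord0 (x ^~ (2 * n)%N) A 0 0 (2 * q * r)).
  rewrite -xE mulnC exprM En /lin !(rmorphD, rmorphM) /=.
  transitivity (q%:~R ^+ 2 * a ^+ 2 + r%:~R ^+ 2 * b ^+ 2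
    + 2 * q%:~R * r%:~R * (a * b)); first by ring.
  by rewrite hb' ha; ring.
(* In [(q a + r b)^3] the coefficient on [a] is [q (q^2 m + 3 r^2 (m+1))], and there is no [ab]
   term. *)
have x3n : x ord0 (3 * n)%N = q * (A + 2 * r ^+ 2 * (m + 1)).
  rewrite -[RHS]addr0; apply: (@sqrt_basis_coord0 (x ^~ (3 * n)%N)
    0 (q * (A + 2 * r ^+ 2 * (m + 1))) (r * (A + 2 * q ^+ 2 * m)) 0).
  rewrite -xE mulnC exprM En /lin !(rmorphD, rmorphM) /=.
  transitivity ((q%:~R * (q%:~R ^+ 2 * a ^+ 2 + 3 * r%:~R ^+ 2 * b ^+ 2)) * a
    + (r%:~R * (r%:~R ^+ 2 * b ^+ 2 + 3 * q%:~R ^+ 2 * a ^+ 2)) * b); first by ring.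
  by rewrite hb' ha; ring.
(* Even [j] starts from [x(0)] and [x(2n)], odd [j] from [x(n)] and [x(3n)]. *)
rewrite -(odd_double_half j) addnC.
apply: (dvdz_rec2 (v := fun l => x ord0 ((l.*2 + odd j) * n)%N) (T := T)) => [l||].
- exact: stepn.
- by case: (odd j); rewrite /= ?mul1n // x0 dvdz0.
case: (odd j); rewrite /= xn; first by rewrite x3n dvdz_mulr.
by rewrite x2n -mulrA dvdz_mull // dvdz_mulr.
Qed.

End SqrtField.

Theorem theorem2 (m : int) (L : fieldExtType rat) (a b : L)
    (hm : forall z : int, m <> z ^+ 2)
    (hm1 : forall z : int, m + 1 <> z ^+ 2)
    (ha : a ^+ 2 = m%:~R) (hb : b ^+ 2 = (m + 1)%:~R) :
  let M := int_adjoin2 a b in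
  let eta := a + b in
  let K : {subfield L} := <<1; eta>>%AS in
  let W := sqrt_basis a b in
  [/\ pos_unit_group K M eta,
      exists F : {subfield L},
        [/\ (F <= K)%VS, \dim F = 2%N & field_unit F (eta ^+ 2)],
      int_basis M W
    & exists x : 'I_4 -> nat -> int,
        (forall k : nat, eta ^+ k = \sum_(i < 4) W`_i *~ x i k) /\
        lin_div_seq (x ord0)].
Proof.
move=> M eta K W; split.
- split; last exact: field_norm_sqrtD hm hm1 ha hb.
  split; first exact: sqrtD_mem.
  move=> y; apply: int_adjoin2M.
  by apply: int_adjoin2D; [apply: int_adjoin2_l | apply: int_adjoin2_r].
- exists <<1; a * b>>%AS; split.
  + exact: quadratic_sub ha hb.
  + exact: dim_quadratic hm hm1 ha hb.
  + exact: field_unit_sqrtD_sqr ha hb.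
- exact: sqrt_basis_int_basis hm hm1 ha hb.
pose x (i : 'I_4) (k : nat) : int :=
  let: (p, q, r, s) := sqrtD_coord m k in [:: q + s; p; r; s]`_i.
have xE k : eta ^+ k = \sum_(i < 4) W`_i *~ x i k.
  rewrite (sqrt_basis_sumE a b (x ^~ k)) /x; have := sqrtD_expE ha hb k.
  by case: (sqrtD_coord m k) => [[[p q] r] s] ->; rewrite /= addrK.
exists x; split=> //; split; first exact: (coord_exp_linear_recurrent hm hm1 ha hb xE).
by move=> n k _ _; apply: (coord0_exp_dvd hm hm1 ha hb xE).
Qed.
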